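(* Let $a>0$ and $0\ne b\in\mathbb R$ with $a^2+3b\ne0$. Then in a neighborhood of $z=0$, $$D_{a,b}(z)=\frac{\phi(g(z))\sqrt{|a^2+3b|}-a}{3b},\qquad C_{a,b}(z)=\frac{\phi(g(z))\sqrt{|a^2+3b|}-a}{3bz},$$ where $$g(z)=\frac{27b^2z+2a^3+9ab}{|a^2+3b|^{3/2}}$$ and $$\phi(u)=\begin{cases}-2\sinh\!\left(\tfrac13\operatorname{arcsinh}(u/2)\right)&\text{if }a^2+3b<0,\\[2pt] 2\cosh\!\left(\tfrac13\operatorname{arcosh}(-u/2)\right)&\text{if }b<0<a^2+3b,\\[2pt] 2\sin\!\left(\tfrac13\arcsin(u/2)\right)&\text{if }b>0.\end{cases}$$
   Context: $C_{a,b}(z)=\sum_{n\ge0}c_n(a,b)z^n$ and $D_{a,b}(z)=zC_{a,b}(z)$, where $c_0(a,b)=1$ and, for $n\ge1$, $c_n(a,b)=a\sum_{u_1+u_2=n-1}c_{u_1}c_{u_2}+b\sum_{u_1+u_2+u_3=n-2}c_{u_1}c_{u_2}c_{u_3}$ (sums over nonnegative integers, $c_u=c_u(a,b)$). Equivalently $D_{a,b}$ is the power series with $D_{a,b}(0)=0$ and $D_{a,b}(z)=z+aD_{a,b}(z)^2+bD_{a,b}(z)^3$. The inverse functions $\operatorname{arcsinh},\operatorname{arcosh},\arcsin$ are taken with their principal branches. *)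

(* Defs.v *)
From Stdlib Require Import Reals Lra Lia Arith.
From Coquelicot Require Import Coquelicot.
Open Scope R_scope.

(** Right-hand side of the recurrence for [c_n], at [n = m + 1].  The
    compositions [u1 + u2 = m] are indexed by [u1 <= m], and the compositions
    [u1 + u2 + u3 = m - 1] by [u1 <= m - 1], [u2 <= m - 1 - u1]; there are none
    of the latter when [m = 0]. *)
Definition coef_step (a b : R) (c : nat -> R) (m : nat) : R :=
  a * sum_f_R0 (fun u => c u * c (m - u)%nat) m +
  b * match m with
      | O => 0
      | S p => sum_f_R0 (fun u =>
                 sum_f_R0 (fun v => c u * c v * c (p - u - v)%nat) (p - u)) p
      end.

(** [coef_upto a b n k] is [c_k(a,b)] for [k <= n]; the values for [k > n] are
    irrelevant.  This only serves to express the course-of-values recursion,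
    see [coef_0] and [coef_S]. *)
Fixpoint coef_upto (a b : R) (n : nat) : nat -> R :=
  match n with
  | O => fun _ => 1
  | S m => fun k => if (k <=? m)%nat then coef_upto a b m k
                    else coef_step a b (coef_upto a b m) m
  end.

Definition coef (a b : R) (n : nat) : R := coef_upto a b n n.

Lemma coef_upto_eq (a b : R) (n k : nat) :
  (k <= n)%nat -> coef_upto a b n k = coef a b k.
Proof.
induction n as [|m IH]; intros Hk.
- now replace k with O by lia.
- destruct (Nat.eq_dec k (S m)) as [->|Hne]; [reflexivity|].
  simpl; replace (k <=? m)%nat with true
    by (symmetry; apply Nat.leb_le; lia).
  apply IH; lia.
Qed.

Lemma coef_step_ext (a b : R) (c d : nat -> R) (m : nat) :
  (forall k, (k <= m)%nat -> c k = d k) ->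
  coef_step a b c m = coef_step a b d m.
Proof.
intros H; unfold coef_step; f_equal; f_equal.
- apply sum_eq; intros u Hu; rewrite !H by lia; reflexivity.
- destruct m as [|p]; [reflexivity|].
  apply sum_eq; intros u Hu; apply sum_eq; intros v Hv.
  rewrite !H by lia; reflexivity.
Qed.

Lemma coef_0 (a b : R) : coef a b 0 = 1.
Proof. reflexivity. Qed.

Lemma coef_S (a b : R) (m : nat) :
  coef a b (S m) = coef_step a b (coef a b) m.
Proof.
unfold coef at 1; cbn [coef_upto].
replace (S m <=? m)%nat with false by (symmetry; apply Nat.leb_gt; lia).
apply coef_step_ext; intros k Hk; now apply coef_upto_eq.
Qed.

(** Coefficients of [C_{a,b}(z)] and of [D_{a,b}(z) = z C_{a,b}(z)], as
    complex power series. *)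
Definition Ccoef (a b : R) (n : nat) : C_NormedModule := RtoC (coef a b n).

Definition Dcoef (a b : R) : nat -> C_NormedModule := PS_incr_1 (Ccoef a b).

Definition Cexp (z : C) : C := (exp (Re z) * cos (Im z), exp (Re z) * sin (Im z)).

(** Principal argument, in [(-PI, PI]] for [z <> 0]. *)
Definition Carg (z : C) : R :=
  if Rle_dec 0 (Im z) then acos (Re z / Cmod z) else - acos (Re z / Cmod z).

(** Principal logarithm and square root, with cut along the negative reals;
    [Clog 0] is a junk value, whence the case distinction in [Csqrt]. *)
Definition Clog (z : C) : C := (ln (Cmod z), Carg z).

Definition Csqrt (z : C) : C :=
  if Ceq_dec z 0 then RtoC 0 else Cexp (Clog z / 2).

Definition Csinh (z : C) : C := ((Cexp z - Cexp (- z)) / 2)%C.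
Definition Ccosh (z : C) : C := ((Cexp z + Cexp (- z)) / 2)%C.
Definition Csin (z : C) : C := ((Cexp (Ci * z) - Cexp (- (Ci * z))) / (2 * Ci))%C.

(** Principal branches.  The factorisation [sqrt (z + 1) * sqrt (z - 1)]
    (rather than [sqrt (z ^ 2 - 1)]) makes the cut of [Carcosh] equal to
    [(-oo, 1]]. *)
Definition Carcsinh (z : C) : C := Clog (z + Csqrt (z * z + 1)).
Definition Carcosh (z : C) : C := Clog (z + Csqrt (z + 1) * Csqrt (z - 1)).
Definition Carcsin (z : C) : C := (- Ci * Clog (Ci * z + Csqrt (1 - z * z)))%C.

(** The three branches are those of [a^2 + 3b < 0], [b < 0 < a^2 + 3b] and
    [b > 0]; they are exhaustive when [b <> 0] and [a^2 + 3b <> 0]. *)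
Definition phi (a b : R) (u : C) : C :=
  if Rlt_dec (a ^ 2 + 3 * b) 0 then (- 2 * Csinh (1 / 3 * Carcsinh (u / 2)))%C
  else if Rlt_dec b 0 then (2 * Ccosh (1 / 3 * Carcosh (- u / 2)))%C
  else (2 * Csin (1 / 3 * Carcsin (u / 2)))%C.

Definition g (a b : R) (z : C) : C :=
  ((RtoC (27 * b ^ 2) * z + RtoC (2 * a ^ 3 + 9 * a * b))
   / RtoC (Rpower (Rabs (a ^ 2 + 3 * b)) (3 / 2)))%C.

(* Main.v *)
Require Import Defs.
From Stdlib Require Import Reals Lra Lia.
From Coquelicot Require Import Coquelicot.
Open Scope R_scope.

(** For small [z] the series [D = z C(z)] converges, satisfies
    [D (1 - a D - b D^2) = z] and is [O(z)]; small solutions of this equation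
    are unique.  Write [E] for the closed form.  Substituting [3 b E + a = k w]
    with [k^2 = |a^2 + 3b|] turns the cubic into [w^3 -+ 3 w + g(z) = 0], which
    [w = phi(g(z))] solves for every [z] by the triple-angle formulas, whatever
    the branches.  That [E] is the small root is where the branches matter:
    [|arg| <= PI] (resp. [|arg| <= PI/2]) confines [phi] to a half-plane (resp.
    to the region between the branches of a hyperbola) on which the cofactor
    [1 - a E - b E^2] is bounded away from [0], whence [E = O(z)].  No continuity
    of the inverse functions is needed, so it does not matter that [g(0)] may
    lie on the cut of [arcosh]. *)

(** * Triple-angle formulas and ranges *)

Lemma Cexp_plus (z w : C) : Cexp (z + w) = (Cexp z * Cexp w)%C.
Proof.
destruct z as [x y], w as [x' y']; unfold Cexp, Cmult, Cplus; simpl.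
rewrite exp_plus, cos_plus, sin_plus; f_equal; ring.
Qed.

Lemma Cexp_0 : Cexp 0 = 1.
Proof. unfold Cexp; simpl; rewrite exp_0, cos_0, sin_0; unfold RtoC; f_equal; ring. Qed.

Lemma Cexp_opp (z : C) : (Cexp z * Cexp (- z))%C = 1.
Proof. rewrite <- Cexp_plus, <- Cexp_0; f_equal; ring. Qed.

Lemma Re_div_Cmod_bounds (z : C) : z <> 0 -> -1 <= Re z / Cmod z <= 1.
Proof.
intros Hz; pose proof (Cmod_gt_0 z) as [H _]; specialize (H Hz).
pose proof (re_le_Cmod z) as Hr; apply Rabs_le_between in Hr.
split; [apply Rle_div_r | apply Rle_div_l]; lra.
Qed.

(** [cos (acos t) = t] recovers the real part, and [sin (acos t) = sqrt (1 - t^2)] the absolute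
    value of the imaginary part; the case distinction in [Carg] supplies its sign. *)
Lemma Cexp_Clog (z : C) : z <> 0 -> Cexp (Clog z) = z.
Proof.
intros Hz; pose proof (Cmod_gt_0 z) as [H _]; specialize (H Hz).
pose proof (Re_div_Cmod_bounds z Hz) as Hb.
assert (Hs : Cmod z * sqrt (1 - (Re z / Cmod z)²) = Rabs (Im z)).
{ rewrite <- (Rabs_pos_eq (Cmod z)) at 1 by lra.
  rewrite <- (sqrt_Rsqr_abs (Cmod z)), <- sqrt_mult_alt by apply Rle_0_sqr.
  rewrite <- sqrt_Rsqr_abs; f_equal; unfold Rsqr.
  assert (Hm : Cmod z * Cmod z = Re z * Re z + Im z * Im z).
  { unfold Cmod; rewrite sqrt_sqrt by nra; unfold Re, Im; ring. }
  replace (Cmod z * Cmod z * (1 - Re z / Cmod z * (Re z / Cmod z)))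
    with (Cmod z * Cmod z - Re z * Re z) by (field; lra).
  lra. }
assert (Hc : Cmod z * (Re z / Cmod z) = Re z) by (field; lra).
transitivity (Re z, Im z); [|now destruct z].
unfold Cexp, Clog; cbn [Re Im fst snd]; rewrite exp_ln by easy.
unfold Carg; destruct (Rle_dec 0 (Im z)) as [Hi|Hi].
- rewrite cos_acos, sin_acos, Hs, Hc by easy; rewrite Rabs_pos_eq; easy.
- rewrite cos_neg, sin_neg, cos_acos, sin_acos, Hc by easy.
  f_equal; rewrite Rabs_left in Hs by lra; unfold Im in *; lra.
Qed.

Lemma cos_le_cos_abs (y m : R) : - m <= y <= m -> m <= PI -> cos m <= cos y.
Proof.
intros Hy Hm; destruct (Rle_dec 0 y) as [H|H].
- apply cos_decr_1; lra.
- rewrite <- (cos_neg y); apply cos_decr_1; lra.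
Qed.

Lemma Im_Clog_bounds (z : C) : - PI <= Im (Clog z) <= PI.
Proof.
cbn; unfold Carg; pose proof (acos_bound (Re z / Cmod z)) as H.
pose proof PI_RGT_0.
destruct (Rle_dec 0 (Im z)); lra.
Qed.

Lemma Im_Clog_bounds_right (z : C) :
  z <> 0 -> 0 <= Re z -> - (PI / 2) <= Im (Clog z) <= PI / 2.
Proof.
intros Hz Hr; cbn; unfold Carg; pose proof (acos_bound (Re z / Cmod z)) as H.
pose proof (Cmod_gt_0 z) as [Hm _]; specialize (Hm Hz).
pose proof (Re_div_Cmod_bounds z Hz) as Hb.
assert (Hq : 0 <= Re z / Cmod z) by (apply Rle_div_r; lra).
assert (acos (Re z / Cmod z) <= PI / 2).
{ destruct (Rle_lt_dec (acos (Re z / Cmod z)) (PI / 2)) as [|Hlt]; [easy|].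
  pose proof (cos_decreasing_1 (PI / 2) (acos (Re z / Cmod z))) as Hd.
  rewrite cos_PI2, cos_acos in Hd by easy.
  pose proof PI_RGT_0; lra. }
destruct (Rle_dec 0 (Im z)); lra.
Qed.

Lemma Csqrt_sqr (z : C) : (Csqrt z * Csqrt z)%C = z.
Proof.
unfold Csqrt; destruct (Ceq_dec z 0) as [->|Hz]; [ring|].
rewrite <- Cexp_plus; transitivity (Cexp (Clog z)); [f_equal; field|].
now apply Cexp_Clog.
Qed.

Lemma Im_div_R (z : C) (r : R) : r <> 0 -> Im (z / RtoC r)%C = Im z / r.
Proof.
intros Hr; unfold Cdiv; rewrite <- RtoC_inv by easy.
rewrite Cmult_comm, im_scal_l; unfold Rdiv; ring.
Qed.

(** Halving the argument puts it in [[-PI/2, PI/2]], where the cosine is nonnegative. *)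
Lemma Re_Csqrt_ge_0 (z : C) : 0 <= Re (Csqrt z).
Proof.
unfold Csqrt; destruct (Ceq_dec z 0) as [->|Hz]; [simpl; lra|].
unfold Cexp; cbn [Re fst]; apply Rmult_le_pos; [left; apply exp_pos|].
rewrite Im_div_R by lra; pose proof (Im_Clog_bounds z).
apply cos_ge_0; lra.
Qed.

(* With [E = exp (T / 3)] one has [E^3 = v + s] and [E^-3 = s - v]. *)
Lemma Csinh_third (T v s : C) :
  Cexp T = (v + s)%C -> (s * s)%C = (v * v + 1)%C ->
  let S := (2 * Csinh (1 / 3 * T))%C in (S * S * S + 3 * S)%C = (2 * v)%C.
Proof.
intros HT Hs S; unfold S, Csinh; clear S.
pose proof (Cexp_opp (1 / 3 * T)) as HEF.
assert (HE : (Cexp (1 / 3 * T) * Cexp (1 / 3 * T) * Cexp (1 / 3 * T))%C = (v + s)%C).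
{ rewrite <- !Cexp_plus, <- HT; f_equal; field. }
set (E := Cexp (1 / 3 * T)) in *; set (F := Cexp (- (1 / 3 * T))) in *.
assert (HF : (F * F * F)%C = (s - v)%C).
{ assert (H1 : ((s - v) * (v + s))%C = 1)
    by (transitivity (s * s - v * v)%C; [ring|rewrite Hs; ring]).
  transitivity (F * F * F * ((s - v) * (v + s)))%C; [rewrite H1; ring|].
  rewrite <- HE.
  transitivity ((s - v) * ((E * F) * (E * F) * (E * F)))%C; [ring|].
  rewrite HEF; ring. }
transitivity (E * E * E - F * F * F - 3 * (E * F) * (E - F) + 3 * (E - F))%C;
  [field|].
rewrite HEF, HE, HF; ring.
Qed.

(** Here [E^-3 = v - s], and [P^3 - 3 P = E^3 + E^-3], in which [s] cancels. Any square root [s] of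
    [v^2 - 1] and any logarithm [T] of [v + s] will do. *)
Lemma Ccosh_third (T v s : C) :
  Cexp T = (v + s)%C -> (s * s)%C = (v * v - 1)%C ->
  let P := (2 * Ccosh (1 / 3 * T))%C in (P * P * P - 3 * P)%C = (2 * v)%C.
Proof.
intros HT Hs P; unfold P, Ccosh; clear P.
pose proof (Cexp_opp (1 / 3 * T)) as HEF.
assert (HE : (Cexp (1 / 3 * T) * Cexp (1 / 3 * T) * Cexp (1 / 3 * T))%C = (v + s)%C).
{ rewrite <- !Cexp_plus, <- HT; f_equal; field. }
set (E := Cexp (1 / 3 * T)) in *; set (F := Cexp (- (1 / 3 * T))) in *.
assert (HF : (F * F * F)%C = (v - s)%C).
{ assert (H1 : ((v - s) * (v + s))%C = 1)
    by (transitivity (v * v - s * s)%C; [ring|rewrite Hs; ring]).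
  transitivity (F * F * F * ((v - s) * (v + s)))%C; [rewrite H1; ring|].
  rewrite <- HE.
  transitivity ((v - s) * ((E * F) * (E * F) * (E * F)))%C; [ring|].
  rewrite HEF; ring. }
transitivity (E * E * E + F * F * F + 3 * (E * F) * (E + F) - 3 * (E + F))%C;
  [field|].
rewrite HEF, HE, HF; ring.
Qed.

Lemma Csinh_parts (z : C) :
  (2 * Csinh z)%C = (2 * sinh (Re z) * cos (Im z), 2 * cosh (Re z) * sin (Im z)).
Proof.
transitivity (Cexp z - Cexp (- z))%C; [unfold Csinh; field|].
destruct z as [x y]; unfold Cexp, Cminus, Cplus, Copp, sinh, cosh; simpl.
rewrite cos_neg, sin_neg; f_equal; field.
Qed.

Lemma Ccosh_parts (z : C) :
  (2 * Ccosh z)%C = (2 * cosh (Re z) * cos (Im z), 2 * sinh (Re z) * sin (Im z)).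
Proof.
transitivity (Cexp z + Cexp (- z))%C; [unfold Ccosh; field|].
destruct z as [x y]; unfold Cexp, Cminus, Cplus, Copp, sinh, cosh; simpl.
rewrite cos_neg, sin_neg; f_equal; field.
Qed.

Lemma cosh_ge_1 (x : R) : 1 <= cosh x.
Proof.
unfold cosh; pose proof (exp_pos x); pose proof (exp_pos (- x)).
assert (exp x * exp (- x) = 1) by (rewrite <- exp_plus, <- exp_0; f_equal; ring).
pose proof (pow2_ge_0 (exp x - exp (- x))).
assert (0 <= (exp x + exp (- x) - 2) * (exp x + exp (- x) + 2)) by nra.
nra.
Qed.

Lemma Im_third (T : C) : Im (1 / 3 * T)%C = Im T / 3.
Proof. replace (1 / 3 * T)%C with (T / 3)%C by field; apply Im_div_R; lra. Qed.

(** [v + s] lies in the closed right half-plane, so a third of its logarithm has imaginary part in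
    [[-PI/6, PI/6]]. The map [2 sinh] sends the two boundary lines of this strip onto the hyperbola
    [3 y^2 = 3 + x^2], whence the inequality. *)
Lemma two_sinh_third_arcsinh (v : C) :
  let S := (2 * Csinh (1 / 3 * Carcsinh v))%C in
  (S * S * S + 3 * S)%C = (2 * v)%C /\ 3 * Im S ^ 2 <= 3 + Re S ^ 2.
Proof.
unfold Carcsinh; set (s := Csqrt (v * v + 1)).
assert (Hs : (s * s)%C = (v * v + 1)%C) by apply Csqrt_sqr.
(* Being invertible, [v + s] is never 0, so the junk value [Clog 0] is never met. *)
assert (H1 : ((v + s) * (s - v))%C = 1)
  by (transitivity (s * s - v * v)%C; [ring|rewrite Hs; ring]).
assert (Hw : (v + s)%C <> 0).
{ intros H0; rewrite H0 in H1.
  assert (H2 : RtoC 0 = 1) by (rewrite <- H1; ring).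
  apply RtoC_inj in H2; lra. }
assert (Hre : 0 <= Re (v + s)%C).
{ assert (Hsr : 0 <= Re s) by apply Re_Csqrt_ge_0.
  (* [1 / (v + s) = s - v], so [s] is the mean of [v + s] and its inverse,
     whose real parts have the same sign. *)
  destruct v as [vx vy], s as [sx sy]; unfold Cmult, Cplus, Cminus, Copp, RtoC in *.
  simpl in *; injection H1; intros H2 H3.
  assert (H4 : (sx - vx) * ((vx + sx) ^ 2 + (vy + sy) ^ 2) = vx + sx).
  { transitivity ((vx + sx) * 1 + (vy + sy) * 0); [rewrite <- H2, <- H3|]; ring. }
  apply Rnot_lt_le; intros Hn.
  assert (0 <= (sx - vx) * ((vx + sx) ^ 2 + (vy + sy) ^ 2)) by
    (apply Rmult_le_pos; [lra|nra]).
  lra. }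
split; [apply (Csinh_third _ v s); [apply Cexp_Clog, Hw|exact Hs]|].
rewrite Csinh_parts; cbn [Re Im fst snd].
set (T := (1 / 3 * Clog (v + s))%C).
assert (Hy : - (PI / 6) <= Im T <= PI / 6).
{ unfold T; rewrite Im_third; pose proof (Im_Clog_bounds_right _ Hw Hre); lra. }
unfold Re, Im in *; set (x := fst T) in *; set (y := snd T) in *.
(* [3/4] is [cos (PI/6) ^ 2]. Once [sin] and [cosh] are eliminated, both the constant term and the
   [sinh x ^ 2] term of the inequality reduce to this bound. *)
assert (Hcos : 3 / 4 <= cos y ^ 2).
{ pose proof (cos_le_cos_abs y (PI / 6) Hy) as Hc.
  rewrite cos_PI6 in Hc; pose proof PI_RGT_0.
  pose proof (sqrt_sqrt 3); pose proof (sqrt_lt_R0 3); nra. }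
pose proof (sin2_cos2 y) as Hsc; unfold Rsqr in Hsc.
pose proof (cosh_ge_1 x).
assert (Hh : cosh x ^ 2 = 1 + sinh x ^ 2).
{ unfold cosh, sinh.
  assert (exp x * exp (- x) = 1) by (rewrite <- exp_plus, <- exp_0; f_equal; ring).
  nra. }
replace ((2 * cosh x * sin y) ^ 2) with (4 * (1 + sinh x ^ 2) * (1 - cos y ^ 2))
 by (rewrite <- Hh; nra).
nra.
Qed.

(** The argument of [v + s] is only known to lie in [[-PI, PI]], but a third of it has cosine at
    least [1/2], so [Re P = 2 cosh x cos y] is at least 1. *)
Lemma two_cosh_third_arcosh (v : C) :
  let P := (2 * Ccosh (1 / 3 * Carcosh v))%C in
  (P * P * P - 3 * P)%C = (2 * v)%C /\ 1 <= Re P.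
Proof.
unfold Carcosh; set (s := (Csqrt (v + 1) * Csqrt (v - 1))%C).
assert (Hs : (s * s)%C = (v * v - 1)%C).
{ transitivity (Csqrt (v + 1) * Csqrt (v + 1) * (Csqrt (v - 1) * Csqrt (v - 1)))%C;
  [unfold s; ring|rewrite !Csqrt_sqr; ring]. }
assert (H1 : ((v + s) * (v - s))%C = 1)
  by (transitivity (v * v - s * s)%C; [ring|rewrite Hs; ring]).
assert (Hw : (v + s)%C <> 0).
{ intros H0; rewrite H0 in H1.
  assert (H2 : RtoC 0 = 1) by (rewrite <- H1; ring).
  apply RtoC_inj in H2; lra. }
split; [apply (Ccosh_third _ v s); [apply Cexp_Clog, Hw|exact Hs]|].
rewrite Ccosh_parts; cbn [Re Im fst snd].
set (T := (1 / 3 * Clog (v + s))%C).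
assert (Hy : - (PI / 3) <= Im T <= PI / 3).
{ unfold T; rewrite Im_third; pose proof (Im_Clog_bounds (v + s)); lra. }
unfold Re, Im in *; set (x := fst T) in *; set (y := snd T) in *.
assert (Hcos : 1 / 2 <= cos y).
{ rewrite <- cos_PI3; pose proof PI_RGT_0; apply cos_le_cos_abs; lra. }
pose proof (cosh_ge_1 x); nra.
Qed.

Lemma Ci_sqr : (Ci * Ci)%C = (- 1)%C.
Proof. unfold Ci, Cmult, Copp, RtoC; simpl; f_equal; ring. Qed.

(** Rotation by [Ci] reduces this to the hyperbolic case: [P = - Ci * S], where [S] belongs to
    [Ci * v]. Up to sign, the rotation exchanges the real and imaginary parts, hence the two
    coordinates in the inequality. *)
Lemma two_sin_third_arcsin (v : C) :
  let P := (2 * Csin (1 / 3 * Carcsin v))%C in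
  (P * P * P - 3 * P)%C = (- (2 * v))%C /\ 3 * Re P ^ 2 <= 3 + Im P ^ 2.
Proof.
assert (Hi : Ci <> 0) by (intros H; apply (f_equal snd) in H; simpl in H; lra).
assert (HP : (2 * Csin (1 / 3 * Carcsin v))%C
             = (- Ci * (2 * Csinh (1 / 3 * Carcsinh (Ci * v))))%C).
{ unfold Carcsin, Carcsinh.
  replace (1 - v * v)%C with (Ci * v * (Ci * v) + 1)%C
    by (transitivity ((Ci * Ci) * (v * v) + 1)%C; [ring|rewrite Ci_sqr; ring]).
  set (L := Clog _).
  assert (HL : (Ci * (1 / 3 * (- Ci * L)))%C = (1 / 3 * L)%C)
    by (transitivity (- (Ci * Ci) * (1 / 3 * L))%C; [ring|rewrite Ci_sqr; ring]).
  unfold Csin, Csinh; rewrite HL.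
  transitivity (- (Ci * Ci) * (Cexp (1 / 3 * L) - Cexp (- (1 / 3 * L))) / Ci)%C;
    [rewrite Ci_sqr; field; easy|field; easy]. }
intros P; unfold P; rewrite HP; clear P HP.
destruct (two_sinh_third_arcsinh (Ci * v)) as [HS Hreg].
set (S := (2 * Csinh (1 / 3 * Carcsinh (Ci * v)))%C) in *.
split.
- transitivity (- Ci * (Ci * Ci) * (S * S * S) + 3 * Ci * S)%C; [ring|].
  transitivity (- Ci * (Ci * Ci) * (S * S * S + 3 * S) + 3 * (1 + Ci * Ci) * Ci * S)%C;
    [ring|].
  rewrite HS; transitivity (- (Ci * Ci) * (Ci * Ci) * (2 * v) + 3 * (1 + Ci * Ci) * Ci * S)%C;
    [ring|].
  rewrite Ci_sqr; ring.
- destruct S as [x y]; unfold Cmult, Copp, Ci in *; simpl in *; lra.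
Qed.

(** * The closed form is a small root of the cubic *)

Lemma le_Cmod_Re (z : C) (r : R) : r <= Rabs (Re z) -> r <= Cmod z.
Proof. pose proof (re_le_Cmod z); lra. Qed.

(** The quadratic is the quotient of [(p^3 + 3 p) - (f^3 + 3 f)] by [p - f]. On the region its real
    part is at least [2 + (f + x/2)^2] plus a nonnegative multiple of [x^2]. *)
Lemma cofactor_sinh_bound (f : R) (p : C) :
  3 * Im p ^ 2 <= 3 + Re p ^ 2 ->
  2 <= Cmod (p * p + RtoC f * p + RtoC (f ^ 2 + 3)).
Proof.
destruct p as [x y]; simpl; intros H; apply le_Cmod_Re; simpl.
eapply Rle_trans; [|apply Rle_abs].
pose proof (pow2_ge_0 (f + x / 2)); nra.
Qed.

(** Minus the real part is bounded below, using [x^2 <= 1 + y^2/3] and its consequence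
    [x <= 1 + y^2/6]. The constant is the value at [p = 1], a vertex of the hyperbola, and factors
    as [(1 - f)(2 + f)]. *)
Lemma cofactor_sin_bound (f : R) (p : C) :
  0 < f < 1 -> 3 * Re p ^ 2 <= 3 + Im p ^ 2 ->
  2 - f - f ^ 2 <= Cmod (p * p + RtoC f * p + RtoC (f ^ 2 - 3)).
Proof.
destruct p as [x y]; simpl; intros Hf H; apply le_Cmod_Re; simpl.
rewrite <- Rabs_Ropp; eapply Rle_trans; [|apply Rle_abs].
assert (x <= 1 + y ^ 2 / 6) by nra.
assert (f * x <= f * (1 + y ^ 2 / 6)) by nra.
nra.
Qed.

(* The constant comes from [Re (q / p)], where [q] is the quadratic. *)
Lemma cofactor_cosh_bound (f : R) (p : C) :
  1 < f -> 1 <= Re p ->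
  Rmin 1 (f ^ 2 + f - 2) <= Cmod (p * p + RtoC f * p + RtoC (f ^ 2 - 3)).
Proof.
intros Hf Hp; set (q := (p * p + RtoC f * p + RtoC (f ^ 2 - 3))%C).
set (c := Rmin 1 (f ^ 2 + f - 2)).
assert (H1 : 1 <= Cmod p)
  by (apply le_Cmod_Re; rewrite Rabs_pos_eq; lra).
assert (H2 : c * Cmod p ^ 2 <= Cmod (q * Cconj p)).
{ apply le_Cmod_Re; eapply Rle_trans; [|apply Rle_abs].
  rewrite Cmod2_alt.
  destruct p as [x y]; unfold q; simpl in *.
  assert (0 < c) by (unfold c; apply Rmin_glb_lt; nra).
  assert (c <= 1) by apply Rmin_l.
  assert (c <= f ^ 2 + f - 2) by apply Rmin_r.
  set (m := x ^ 2 + y ^ 2).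
  replace (_ * x - _ * - y) with (m * (x + f) + (f ^ 2 - 3) * x)
    by (unfold m; ring).
  replace (_ + _) with m at 1 by (unfold m; ring).
  (* If [f^2 >= 3] the term [(f^2 - 3) x] helps; otherwise it is absorbed into the main term through
     [x <= x^2 <= m]. *)
  destruct (Rle_dec 3 (f ^ 2)).
  - assert (0 <= m) by (unfold m; nra). nra.
  - assert (x <= m) by (unfold m; nra).
    assert ((3 - f ^ 2) * x <= (3 - f ^ 2) * m) by (apply Rmult_le_compat_l; lra).
    assert (c * m <= (f ^ 2 + f - 2) * m) by (apply Rmult_le_compat_r; lra).
    assert (m <= m * x) by nra.
    lra. }
rewrite Cmod_mult, Cmod_conj in H2.
apply Rmult_le_reg_r with (Cmod p); [lra|].
assert (0 < c) by (unfold c; apply Rmin_glb_lt; nra).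
assert (c * Cmod p <= c * Cmod p ^ 2) by (apply Rmult_le_compat_l; nra).
lra.
Qed.

(** [s] is the sign of [a^2 + 3b]. The value [w = a / k] corresponds to [E = 0], and the quadratic
    is what remains of [w^3 - 3 s w], minus its value at [a / k], after division by [w - a / k]. *)
Lemma phi_root_bound (a b : R) (ha : 0 < a) (hb : b <> 0)
    (hab : a ^ 2 + 3 * b <> 0) :
  let k := sqrt (Rabs (a ^ 2 + 3 * b)) in
  exists s c : R, s * k ^ 2 = a ^ 2 + 3 * b /\ 0 < c /\
  forall u : C,
    (phi a b u * phi a b u * phi a b u - 3 * s * phi a b u + u)%C = 0 /\
    c <= Cmod (phi a b u * phi a b u + RtoC (a / k) * phi a b u
               + RtoC ((a / k) ^ 2 - 3 * s)).
Proof.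
intros k.
assert (Hk : 0 < k) by (apply sqrt_lt_R0, Rabs_pos_lt, hab).
assert (Hk2 : k ^ 2 = Rabs (a ^ 2 + 3 * b))
  by (unfold k; rewrite pow2_sqrt; [easy|apply Rabs_pos]).
assert (Hf : (a / k) * k = a) by (field; lra).
assert (Hf0 : 0 < a / k) by (apply Rdiv_lt_0_compat; lra).
unfold phi; destruct (Rlt_dec (a ^ 2 + 3 * b) 0) as [Hneg|Hpos];
  [|destruct (Rlt_dec b 0) as [Hb|Hb]].
- exists (- 1), 2; rewrite Hk2, Rabs_left by lra.
  split; [ring|split; [lra|intros u]].
  destruct (two_sinh_third_arcsinh (u / 2)) as [HS Hreg].
  replace (-2 * Csinh (1 / 3 * Carcsinh (u / 2)))%C
    with (- (2 * Csinh (1 / 3 * Carcsinh (u / 2))))%C by (ring).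
  set (S := (2 * Csinh (1 / 3 * Carcsinh (u / 2)))%C) in *.
  split.
  + transitivity (u - (S * S * S + 3 * S))%C; [ring|rewrite HS; field].
  + replace ((a / k) ^ 2 - 3 * -1) with ((a / k) ^ 2 + 3) by ring.
    apply cofactor_sinh_bound; destruct S as [x y]; simpl in *; lra.
- rewrite Rabs_pos_eq in Hk2 by lra.
  exists 1, (Rmin 1 ((a / k) ^ 2 + a / k - 2)).
  (* [b < 0] means [k^2 = a^2 + 3b < a^2]; this makes [(f - 1)(f + 2)] positive for [f = a / k]. *)
  assert (H1 : 1 < a / k) by (apply Rlt_div_r; nra).
  split; [lra|split; [apply Rmin_glb_lt; nra|intros u]].
  destruct (two_cosh_third_arcosh (- u / 2)) as [HS Hreg].
  set (S := (2 * Ccosh (1 / 3 * Carcosh (- u / 2)))%C) in *.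
  split.
  + transitivity (u + (S * S * S - 3 * S))%C; [ring|rewrite HS; field].
  + replace ((a / k) ^ 2 - 3 * 1) with ((a / k) ^ 2 - 3) by ring.
    now apply cofactor_cosh_bound.
- rewrite Rabs_pos_eq in Hk2 by lra.
  exists 1, (2 - a / k - (a / k) ^ 2).
  (* Now [b > 0], so [k^2 > a^2]. *)
  assert (H1 : a / k < 1) by (apply Rlt_div_l; nra).
  split; [lra|split; [nra|intros u]].
  destruct (two_sin_third_arcsin (u / 2)) as [HS Hreg].
  set (S := (2 * Csin (1 / 3 * Carcsin (u / 2)))%C) in *.
  split.
  + transitivity (u + (S * S * S - 3 * S))%C; [ring|rewrite HS; field].
  + replace ((a / k) ^ 2 - 3 * 1) with ((a / k) ^ 2 - 3) by ring.
    now apply cofactor_sin_bound.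
Qed.

Definition closed_form (a b : R) (z : C) : C :=
  ((phi a b (g a b z) * RtoC (sqrt (Rabs (a ^ 2 + 3 * b))) - RtoC a)
     / RtoC (3 * b))%C.

Lemma closed_form_root (a b : R) (ha : 0 < a) (hb : b <> 0)
    (hab : a ^ 2 + 3 * b <> 0) :
  exists c : R, 0 < c /\ forall z : C,
    let E := closed_form a b z in
    let q := (1 - RtoC a * E - RtoC b * (E * E))%C in
    (E * q)%C = z /\ c <= Cmod q.
Proof.
destruct (phi_root_bound a b ha hb hab) as (s & c & Hs & Hc & Hphi).
set (k := sqrt (Rabs (a ^ 2 + 3 * b))) in *.
assert (Hk : 0 < k) by (apply sqrt_lt_R0, Rabs_pos_lt, hab).
assert (Hpow : Rpower (Rabs (a ^ 2 + 3 * b)) (3 / 2) = k * k * k).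
{ replace (3 / 2) with (1 + / 2) by lra.
  pose proof (Rabs_pos_lt _ hab).
  rewrite Rpower_plus, Rpower_1, Rpower_sqrt by easy.
  fold k; f_equal; unfold k; rewrite sqrt_sqrt; lra. }
assert (Hb0 : 0 < Rabs b) by now apply Rabs_pos_lt.
(* Substituting [3 b E + a = k p] gives [- 9 b q = k^2 Q], with [Q] the quadratic bounded below by
   [c]. *)
exists (k ^ 2 * c / (9 * Rabs b)).
split; [apply Rdiv_lt_0_compat; [apply Rmult_lt_0_compat; [nra|lra]|lra]|].
intros z E q; destruct (Hphi (g a b z)) as [Hroot Hbnd].
unfold q, E, closed_form; clear q E; fold k.
set (p := phi a b (g a b z)) in *.
unfold g in Hroot; rewrite Hpow in Hroot.
assert (HB : RtoC b <> 0) by (intros H; now apply RtoC_inj in H).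
assert (HK : RtoC k <> 0) by (intros H; apply RtoC_inj in H; lra).
assert (HsC : (RtoC s * (RtoC k * RtoC k))%C = (RtoC a * RtoC a + 3 * RtoC b)%C).
{ rewrite <- !RtoC_mult, <- RtoC_plus; f_equal; lra. }
replace (RtoC (27 * b ^ 2)) with (27 * (RtoC b * RtoC b))%C in Hroot
  by (rewrite <- !RtoC_mult; f_equal; ring).
replace (RtoC (2 * a ^ 3 + 9 * a * b))
  with (2 * (RtoC a * RtoC a * RtoC a) + 9 * RtoC a * RtoC b)%C in Hroot
  by (rewrite <- !RtoC_mult, <- RtoC_plus; f_equal; ring).
rewrite !RtoC_mult in Hroot.
rewrite RtoC_mult.
split.
- set (T := (p * p * p - _ + _)%C) in Hroot.
  set (A := RtoC a) in *; set (B := RtoC b) in *; set (K := RtoC k) in *.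
  (* [E q - z] is a combination of the reduced cubic [T] and of [a^2 + 3b - s k^2], both of which
     vanish. *)
  transitivity (z - K * K * K * T / (27 * (B * B))
     + ((A * A + 3 * B) - RtoC s * (K * K)) * (p * K) / (9 * (B * B)))%C.
  + unfold T; field; easy.
  + rewrite Hroot, HsC; field; easy.
- apply Rle_div_l; [lra|].
  rewrite (RtoC_minus _ (3 * s)), (RtoC_mult 3 s), RtoC_pow, RtoC_div in Hbnd by lra.
  set (Q := (p * p + _ + _)%C) in Hbnd.
  replace (9 * Rabs b) with (Cmod (9 * RtoC b))
    by (rewrite Cmod_mult, !Cmod_R, (Rabs_pos_eq 9); lra).
  rewrite <- Cmod_mult, <- Cmod_opp.
  replace (- _)%C with (RtoC (k ^ 2) * Q)%C.
  + rewrite Cmod_mult, Cmod_R, Rabs_pos_eq by nra.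
    apply Rmult_le_compat_l; [nra|exact Hbnd].
  + unfold Q; rewrite RtoC_pow.
    set (A := RtoC a) in *; set (B := RtoC b) in *; set (K := RtoC k) in *.
    transitivity (K ^ 2 * p ^ 2 + A * K * p + A ^ 2 - 3 * (RtoC s * (K * K)))%C;
      [field; easy|rewrite HsC; field; easy].
Qed.

(** * The power series *)

Lemma PS_mult_nonneg (x y : nat -> R) (n : nat) :
  (forall k, 0 <= x k) -> (forall k, 0 <= y k) -> 0 <= PS_mult x y n.
Proof.
intros Hx Hy; apply cond_pos_sum; intros k; now apply Rmult_le_pos.
Qed.

(** The left side sums [x k * y l] over the triangle [k + l <= N], the right side over the whole
    square; the difference is a sum of nonnegative terms. *)
Lemma sum_PS_mult_le (x y : nat -> R) (N : nat) :
  (forall k, 0 <= x k) -> (forall k, 0 <= y k) ->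
  sum_f_R0 (PS_mult x y) N <= sum_f_R0 x N * sum_f_R0 y N.
Proof.
intros Hx Hy; destruct N as [|N]; [unfold PS_mult; simpl; lra|].
rewrite cauchy_finite by lia; unfold PS_mult.
match goal with |- ?A <= ?B + ?D => assert (0 <= D) end; [|lra].
apply cond_pos_sum; intros k; apply cond_pos_sum; intros l.
now apply Rmult_le_pos.
Qed.

Lemma PS_mult_pow (x y : nat -> R) (r : R) (n : nat) :
  PS_mult (fun k => x k * r ^ k) (fun k => y k * r ^ k) n = PS_mult x y n * r ^ n.
Proof.
unfold PS_mult; rewrite (Rmult_comm _ (r ^ n)), scal_sum; apply sum_eq; intros k Hk.
replace (r ^ n) with (r ^ k * r ^ (n - k)) by (rewrite <- pow_add; f_equal; lia).
ring.
Qed.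

Lemma Rabs_PS_mult_le (x y : nat -> R) (n : nat) :
  Rabs (PS_mult x y n) <= PS_mult (fun k => Rabs (x k)) (fun k => Rabs (y k)) n.
Proof.
eapply Rle_trans; [apply Rsum_abs|apply Req_le, sum_eq; intros; apply Rabs_mult].
Qed.

Lemma PS_mult_le (x y x' y' : nat -> R) (n : nat) :
  (forall k, 0 <= x k <= x' k) -> (forall k, 0 <= y k <= y' k) ->
  PS_mult x y n <= PS_mult x' y' n.
Proof.
intros Hx Hy; apply sum_Rle; intros k _; apply Rmult_le_compat; apply Hx || apply Hy.
Qed.

(** [PS_incr_1] accounts both for the index [n - 1] of the triple convolution and for its absence at
    [n = 0]. *)
Lemma coef_S_PS_mult (a b : R) (n : nat) :
  let c := coef a b in
  c (S n) = a * PS_mult c c n + b * PS_incr_1 (PS_mult c (PS_mult c c)) n.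
Proof.
intros c; unfold c; rewrite coef_S; unfold coef_step; fold c.
f_equal; f_equal; destruct n as [|p]; [reflexivity|].
simpl; unfold PS_mult; apply sum_eq; intros u Hu.
rewrite scal_sum; apply sum_eq; intros v Hv; ring.
Qed.

(* With [S_N] the [N]-th partial sum, the recurrence gives
   [S_(N+1) <= 1 + |a| r S_N^2 + |b| r^2 S_N^3], so [S_N <= 2] is preserved. *)
Lemma sum_coef_le (a b r : R) :
  0 <= r -> 4 * Rabs a * r + 8 * Rabs b * r ^ 2 <= 1 ->
  forall N, sum_f_R0 (fun n => Rabs (coef a b n) * r ^ n) N <= 2.
Proof.
intros Hr Hsmall; set (c := coef a b); set (x := fun n => Rabs (c n) * r ^ n).
pose proof (Rabs_pos a) as Ha; pose proof (Rabs_pos b) as Hb.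
assert (Hx : forall n, 0 <= x n)
  by (intros n; apply Rmult_le_pos; [apply Rabs_pos|now apply pow_le]).
assert (Hxx : forall n, 0 <= PS_mult x x n) by (intros; now apply PS_mult_nonneg).
set (x3 := PS_mult x (PS_mult x x)).
assert (Hx3 : forall n, 0 <= x3 n) by (intros; now apply PS_mult_nonneg).
assert (H2 : forall n, Rabs (PS_mult c c n) * r ^ n <= PS_mult x x n).
{ intros n; unfold x; rewrite PS_mult_pow.
  apply Rmult_le_compat_r; [now apply pow_le|apply Rabs_PS_mult_le]. }
assert (H3 : forall n, Rabs (PS_mult c (PS_mult c c) n) * r ^ n <= x3 n).
{ intros n; eapply Rle_trans;
    [apply Rmult_le_compat_r; [now apply pow_le|apply Rabs_PS_mult_le]|].
  rewrite <- (PS_mult_pow (fun k => Rabs (c k))); apply PS_mult_le; intros k; split.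
  - apply Hx.
  - apply Rle_refl.
  - apply Rmult_le_pos; [apply Rabs_pos|now apply pow_le].
  - apply H2. }
assert (Hrec : forall n, x (S n) <= Rabs a * r * PS_mult x x n
                                    + Rabs b * r ^ 2 * PS_incr_1 x3 n).
{ intros n; unfold x at 1, c; rewrite coef_S_PS_mult; fold c.
  eapply Rle_trans; [apply Rmult_le_compat_r; [now apply pow_le|apply Rabs_triang]|].
  rewrite !Rabs_mult, Rmult_plus_distr_r; apply Rplus_le_compat.
  - replace (_ * r ^ S n)
      with (Rabs a * r * (Rabs (PS_mult c c n) * r ^ n)) by (simpl; ring).
    apply Rmult_le_compat_l; [now apply Rmult_le_pos|apply H2].
  - destruct n as [|p]; simpl PS_incr_1.
    + change (@zero _) with 0; rewrite Rabs_R0; lra.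
    + replace (_ * r ^ S (S p)) with
        (Rabs b * r ^ 2 * (Rabs (PS_mult c (PS_mult c c) p) * r ^ p)) by (simpl; ring).
      apply Rmult_le_compat_l; [apply Rmult_le_pos; [easy|now apply pow_le]|apply H3]. }
intros N; induction N as [|N IH].
- simpl; unfold x, c; rewrite coef_0, Rabs_R1; simpl; lra.
- rewrite decomp_sum by lia; simpl pred.
  assert (Hx0 : x 0%nat = 1) by (unfold x, c; rewrite coef_0, Rabs_R1; simpl; ring).
  rewrite Hx0.
  eapply Rle_trans; [apply Rplus_le_compat_l, sum_Rle; intros n _; apply Hrec|].
  assert (HS : 0 <= sum_f_R0 x N) by now apply cond_pos_sum.
  assert (E2 : sum_f_R0 (PS_mult x x) N <= 4)
    by (eapply Rle_trans; [now apply sum_PS_mult_le|nra]).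
  assert (E3 : sum_f_R0 x3 N <= 8).
  { eapply Rle_trans; [now apply sum_PS_mult_le|].
    replace 8 with (2 * 4) by ring.
    apply Rmult_le_compat; [easy|now apply cond_pos_sum|easy|easy]. }
  (* The shift prepends a zero and drops the last term, which is nonnegative. *)
  assert (E4 : sum_f_R0 (PS_incr_1 x3) N <= 8).
  { destruct N as [|N]; [simpl; change (@zero _) with 0; lra|].
    rewrite decomp_sum by lia; rewrite tech5 in E3; pose proof (Hx3 (S N)).
    change (0 + sum_f_R0 x3 N <= 8); lra. }
  rewrite (sum_eq _ (fun n => PS_mult x x n * (Rabs a * r)
                              + PS_incr_1 x3 n * (Rabs b * r ^ 2)))
    by (intros; ring).
  rewrite sum_plus, <- !scal_sum.
  assert (0 <= Rabs a * r) by now apply Rmult_le_pos.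
  assert (0 <= Rabs b * r ^ 2) by (apply Rmult_le_pos; [easy|now apply pow_le]).
  nra.
Qed.

(** * Complex series through their real and imaginary parts *)

Lemma sum_n_Re_Im (u : nat -> C_NormedModule) (n : nat) :
  sum_n u n = (sum_n (fun k => Re (u k)) n, sum_n (fun k => Im (u k)) n).
Proof.
induction n as [|n IH]; [rewrite !sum_O; now destruct (u O)|].
rewrite !sum_Sn, IH; reflexivity.
Qed.

Lemma sum_n_RtoC (x : nat -> R) (n : nat) :
  sum_n (fun k => RtoC (x k) : C_NormedModule) n = RtoC (sum_n x n).
Proof.
induction n as [|n IH]; [now rewrite !sum_O|].
rewrite !sum_Sn, IH; symmetry; apply RtoC_plus.
Qed.

(** The uniform structure on [C] is that of the product, so a ball is a pair of real balls. *)
Lemma is_series_Re_Im (u : nat -> C_NormedModule) (l : C) :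
  is_series u l <->
  is_series (fun n => Re (u n)) (Re l) /\ is_series (fun n => Im (u n)) (Im l).
Proof.
unfold is_series; split.
- intros H; split; intros P [eps HP].
  + destruct (H (fun w => P (Re w))) as [N HN].
    * exists eps; intros w [Hw _]; now apply HP.
    * exists N; intros n Hn; specialize (HN n Hn); now rewrite sum_n_Re_Im in HN.
  + destruct (H (fun w => P (Im w))) as [N HN].
    * exists eps; intros w [_ Hw]; now apply HP.
    * exists N; intros n Hn; specialize (HN n Hn); now rewrite sum_n_Re_Im in HN.
- intros [H1 H2] P [eps HP].
  destruct (H1 (ball (Re l) eps)) as [N1 HN1]; [apply locally_ball|].
  destruct (H2 (ball (Im l) eps)) as [N2 HN2]; [apply locally_ball|].
  exists (N1 + N2)%nat; intros n Hn; apply HP; rewrite sum_n_Re_Im; split.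
  + apply HN1; lia.
  + apply HN2; lia.
Qed.

Lemma pow_n_Cpow (z : C) (n : nat) : pow_n (K := C_AbsRing) z n = Cpow z n.
Proof. induction n as [|n IH]; [reflexivity|]. simpl; now rewrite IH. Qed.

Lemma Rabs_Im_le_Cmod (z : C) : Rabs (Im z) <= Cmod z.
Proof. eapply Rle_trans; [apply Rmax_r|apply Rmax_Cmod]. Qed.

Lemma Cmod_le_Re_Im (z : C) : Cmod z <= Rabs (Re z) + Rabs (Im z).
Proof.
pose proof (Cmod_ge_0 z); pose proof (Rabs_pos (Re z)); pose proof (Rabs_pos (Im z)).
apply Rsqr_incr_0_var; [|lra].
pose proof (Cmod2_alt z) as H2; rewrite <- (pow2_abs (Re z)), <- (pow2_abs (Im z)) in H2.
unfold Rsqr; nra.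
Qed.

(** The real theorem on Cauchy products is applied to the four products of real and imaginary parts,
    whose absolute convergence follows by comparison with [Cmod]. *)
Lemma is_series_mult_C (u v : nat -> C_NormedModule) (l m : C) :
  is_series u l -> is_series v m ->
  ex_series (fun n => Cmod (u n)) -> ex_series (fun n => Cmod (v n)) ->
  is_series (fun n => sum_n (fun k => (u k * v (n - k)%nat)%C : C_NormedModule) n)
    ((l * m)%C : C_NormedModule).
Proof.
intros Hu Hv Au Av.
apply is_series_Re_Im in Hu as [Hu1 Hu2]; apply is_series_Re_Im in Hv as [Hv1 Hv2].
assert (HRe : forall w : nat -> C, ex_series (fun n => Cmod (w n)) ->
  ex_series (fun n => Rabs (Re (w n))) /\ ex_series (fun n => Rabs (Im (w n)))).
{ intros w Hw; split; apply (ex_series_le (V := R_CompleteNormedModule)) with (2 := Hw);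
  intros n; eapply Rle_trans; try (apply Req_le, Rabs_Rabsolu);
  [apply re_le_Cmod|apply Rabs_Im_le_Cmod]. }
destruct (HRe u Au), (HRe v Av).
apply is_series_Re_Im; split.
- refine (is_series_ext _ _ _ _ (is_series_minus _ _ _ _
    (is_series_mult _ _ _ _ Hu1 Hv1 _ _) (is_series_mult _ _ _ _ Hu2 Hv2 _ _)));
    try easy.
  intros n; rewrite sum_n_Re_Im; simpl; rewrite sum_n_Reals; symmetry.
  apply (minus_sum (fun k => Re (u k) * Re (v (n - k)%nat))).
- refine (is_series_ext _ _ _ _ (is_series_plus _ _ _ _
    (is_series_mult _ _ _ _ Hu1 Hv2 _ _) (is_series_mult _ _ _ _ Hu2 Hv1 _ _)));
    try easy.
  intros n; rewrite sum_n_Re_Im; simpl; rewrite sum_n_Reals; symmetry.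
  apply (sum_plus (fun k => Re (u k) * Im (v (n - k)%nat))).
Qed.

Lemma Cmod_scal_pow_n (x : R) (z : C) (n : nat) :
  Cmod (scal (pow_n (K := C_AbsRing) z n) (RtoC x : C_NormedModule)) = Rabs x * Cmod z ^ n.
Proof.
change (Cmod (pow_n (K := C_AbsRing) z n * RtoC x) = Rabs x * Cmod z ^ n).
rewrite pow_n_Cpow, Cmod_mult, Cmod_pow, Cmod_R; ring.
Qed.

Lemma is_pseries_PS_mult_C (c d : nat -> R) (z l m : C) :
  ex_series (fun n => Rabs (c n) * Cmod z ^ n) ->
  ex_series (fun n => Rabs (d n) * Cmod z ^ n) ->
  is_pseries (fun n => RtoC (c n) : C_NormedModule) z l ->
  is_pseries (fun n => RtoC (d n) : C_NormedModule) z m ->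
  is_pseries (fun n => RtoC (PS_mult c d n) : C_NormedModule) z ((l * m)%C : C_NormedModule).
Proof.
intros Ac Ad Hc Hd.
refine (is_series_ext _ _ _ _ (is_series_mult_C _ _ _ _ Hc Hd _ _)).
- intros n; change (sum_n (fun k => (pow_n (K := C_AbsRing) z k * RtoC (c k) *
    (pow_n (K := C_AbsRing) z (n - k) * RtoC (d (n - k)%nat)))%C : C_NormedModule) n =
    (pow_n (K := C_AbsRing) z n * RtoC (PS_mult c d n))%C).
  rewrite (sum_n_ext_loc _ (fun k => scal (pow_n (K := C_AbsRing) z n)
    (RtoC (c k * d (n - k)%nat) : C_NormedModule))).
  + rewrite sum_n_scal_l, sum_n_RtoC, sum_n_Reals; reflexivity.
  + intros k Hk.
    change (pow_n (K := C_AbsRing) z k * RtoC (c k) *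
      (pow_n (K := C_AbsRing) z (n - k) * RtoC (d (n - k)%nat)) =
      pow_n (K := C_AbsRing) z n * RtoC (c k * d (n - k)%nat))%C.
    rewrite RtoC_mult, (pow_n_Cpow z k), (pow_n_Cpow z (n - k)), (pow_n_Cpow z n).
    replace (z ^ n)%C with (z ^ k * z ^ (n - k))%C
      by (rewrite <- Cpow_add_r; f_equal; lia).
    ring.
- apply (ex_series_ext (fun n => Rabs (c n) * Cmod z ^ n)); [|easy].
  intros n; now rewrite Cmod_scal_pow_n.
- apply (ex_series_ext (fun n => Rabs (d n) * Cmod z ^ n)); [|easy].
  intros n; now rewrite Cmod_scal_pow_n.
Qed.

Lemma ex_series_Rabs_PS_mult (c d : nat -> R) (r : R) :
  0 <= r -> ex_series (fun n => Rabs (c n) * r ^ n) ->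
  ex_series (fun n => Rabs (d n) * r ^ n) ->
  ex_series (fun n => Rabs (PS_mult c d n) * r ^ n).
Proof.
intros Hr [lc Hc] [ld Hd].
assert (Hpos : forall (e : nat -> R) n, 0 <= Rabs (e n) * r ^ n)
  by (intros; apply Rmult_le_pos; [apply Rabs_pos|now apply pow_le]).
apply (ex_series_le (V := R_CompleteNormedModule)) with
  (b := PS_mult (fun n => Rabs (c n) * r ^ n) (fun n => Rabs (d n) * r ^ n)).
- intros n; change (Rabs (Rabs (PS_mult c d n) * r ^ n) <=
    PS_mult (fun n => Rabs (c n) * r ^ n) (fun n => Rabs (d n) * r ^ n) n).
  rewrite Rabs_pos_eq by apply (Hpos (PS_mult c d)).
  rewrite (PS_mult_pow (fun n => Rabs (c n)) (fun n => Rabs (d n))).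
  apply Rmult_le_compat_r; [now apply pow_le|apply Rabs_PS_mult_le].
- exists (lc * ld); apply is_series_mult_pos; try easy; apply Hpos.
Qed.

(** The bound on the partial sums gives absolute convergence, so Cauchy products may be summed and
    the recurrence becomes an equation for the sum. The constant 4 is [2 + 2], one 2 for each of the
    real and imaginary parts. *)
Lemma ex_pseries_Ccoef (a b : R) (z : C) :
  4 * Rabs a * Cmod z + 8 * Rabs b * Cmod z ^ 2 <= 1 ->
  exists l : C, is_pseries (Ccoef a b) z l /\ Cmod l <= 4 /\
    l = (1 + z * (RtoC a * (l * l) + RtoC b * z * (l * (l * l))))%C.
Proof.
intros Hz; set (c := coef a b).
pose proof (Cmod_ge_0 z) as Hr.
pose proof (sum_coef_le a b (Cmod z) Hr Hz) as Hsum; fold c in Hsum.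
assert (Hpos : forall n, 0 <= Rabs (c n) * Cmod z ^ n)
  by (intros; apply Rmult_le_pos; [apply Rabs_pos|now apply pow_le]).
assert (Habs : ex_series (fun n => Rabs (c n) * Cmod z ^ n)).
{ destruct (ex_finite_lim_seq_incr (sum_n (fun n => Rabs (c n) * Cmod z ^ n)) 2)
    as [s Hs]; [| |now exists s].
  - intros n; rewrite sum_Sn; pose proof (Hpos (S n)); unfold plus; simpl; simpl in *; lra.
  - intros n; rewrite sum_n_Reals; apply Hsum. }
set (u := fun n => scal (pow_n (K := C_AbsRing) z n) (Ccoef a b n)).
assert (Hu : forall n, Cmod (u n) = Rabs (c n) * Cmod z ^ n)
  by (intros; apply Cmod_scal_pow_n).
assert (HS : Series (fun n => Rabs (c n) * Cmod z ^ n) <= 2).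
{ apply (is_lim_seq_le (sum_n (fun n => Rabs (c n) * Cmod z ^ n)) (fun _ => 2)
    (Series (fun n => Rabs (c n) * Cmod z ^ n)) 2).
  - intros n; rewrite sum_n_Reals; apply Hsum.
  - now apply Series_correct.
  - apply is_lim_seq_const. }
assert (Hpart : forall p : C -> R, (forall w, Rabs (p w) <= Cmod w) ->
  is_series (fun n => p (u n)) (Series (fun n => p (u n))) /\
  Rabs (Series (fun n => p (u n))) <= 2).
{ intros p Hp.
  assert (Hle : forall n, 0 <= Rabs (p (u n)) <= Rabs (c n) * Cmod z ^ n)
    by (intros n; split; [apply Rabs_pos|rewrite <- Hu; apply Hp]).
  assert (Hex : ex_series (fun n => Rabs (p (u n)))).
  { apply (ex_series_le (V := R_CompleteNormedModule)) with (2 := Habs).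
    intros n; change (Rabs (Rabs (p (u n))) <= Rabs (c n) * Cmod z ^ n).
    rewrite Rabs_Rabsolu; apply Hle. }
  split; [now apply Series_correct, ex_series_Rabs|].
  eapply Rle_trans; [now apply Series_Rabs|].
  eapply Rle_trans; [apply (Series_le _ _ Hle Habs)|exact HS]. }
destruct (Hpart Re re_le_Cmod) as [HRe BRe].
destruct (Hpart Im Rabs_Im_le_Cmod) as [HIm BIm].
set (l := (Series (fun n => Re (u n)), Series (fun n => Im (u n))) : C).
assert (Hl : is_pseries (Ccoef a b) z l) by (apply is_series_Re_Im; now split).
exists l; split; [exact Hl|split].
{ eapply Rle_trans; [apply Cmod_le_Re_Im|].
  replace 4 with (2 + 2) by ring; exact (Rplus_le_compat _ _ _ _ BRe BIm). }
assert (Habs2 := ex_series_Rabs_PS_mult c c _ Hr Habs Habs).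
assert (Hl2 := is_pseries_PS_mult_C c c z l l Habs Habs Hl Hl).
assert (Hl3 := is_pseries_PS_mult_C c (PS_mult c c) z l _ Habs Habs2 Hl Hl2).
assert (Hrec := is_series_scal (z : C_AbsRing) _ _ (is_pseries_plus _ _ _ _ _
  (is_pseries_scal (RtoC a : C_AbsRing) _ z _ (Cmult_comm _ _) Hl2)
  (is_pseries_scal (RtoC b : C_AbsRing) _ z _ (Cmult_comm _ _)
    (is_pseries_incr_1 _ _ _ Hl3)))).
assert (Htail : is_series (fun n => u (S n)) ((l - 1)%C : C_NormedModule)).
{ apply is_series_incr_1; replace (plus _ _) with (l : C_NormedModule); [exact Hl|].
  change (l = l - 1 + 1 * 1)%C; ring. }
(* By the recurrence times [z^(n+1)], both sides are sums of the series without its initial term,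
   and limits are unique. *)
assert (Heq : (l - 1)%C = (z * (RtoC a * (l * l) + RtoC b * (z * (l * (l * l)))))%C).
{ apply (filterlim_locally_unique (F := eventually) _ _ _ Htail).
  refine (is_series_ext _ _ _ _ Hrec); intros n.
  change (z * (pow_n (K := C_AbsRing) z n * (RtoC a * RtoC (PS_mult c c n) +
    RtoC b * PS_incr_1 (V := C_NormedModule)
       (fun n => RtoC (PS_mult c (PS_mult c c) n)) n)) =
    z * pow_n (K := C_AbsRing) z n * RtoC (c (S n)))%C.
  unfold c at 6; rewrite coef_S_PS_mult; fold c.
  rewrite RtoC_plus, !RtoC_mult.
  replace (PS_incr_1 (V := C_NormedModule) _ n)
    with (RtoC (PS_incr_1 (PS_mult c (PS_mult c c)) n)) by now destruct n.
  rewrite pow_n_Cpow; ring. }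
transitivity (1 + (l - 1))%C; [ring|rewrite Heq; ring].
Qed.

(** * Uniqueness of the small root and identification of the sum *)

(** The difference of the two sides factors as [(D - E)(1 - W)], and
    [|W| <= d (2|a| + 3|b|) <= 1 - d < 1]. The first hypothesis also gives [d <= 1], so products of
    elements of the disc stay in it. *)
Lemma small_root_unique (a b d : R) (D E : C) :
  d * (1 + 2 * Rabs a + 3 * Rabs b) <= 1 -> 0 < d ->
  Cmod D <= d -> Cmod E <= d ->
  (D * (1 - RtoC a * D - RtoC b * (D * D)))%C
  = (E * (1 - RtoC a * E - RtoC b * (E * E)))%C -> D = E.
Proof.
intros Hd Hd0 HD HE Heq.
pose proof (Rabs_pos a) as Ha; pose proof (Rabs_pos b) as Hb.
set (W := (RtoC a * (D + E) + RtoC b * (D * D + D * E + E * E))%C).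
assert (H0 : ((D - E) * (1 - W))%C = 0).
{ transitivity (D * (1 - RtoC a * D - RtoC b * (D * D))
     - E * (1 - RtoC a * E - RtoC b * (E * E)))%C; [unfold W; ring|].
  rewrite Heq; ring. }
assert (HW : Cmod W < 1).
{ pose proof (Cmod_ge_0 D) as HD0; pose proof (Cmod_ge_0 E) as HE0.
  assert (H1 : Cmod (D + E) <= 2 * d) by (pose proof (Cmod_triangle D E); lra).
  assert (Hprod : forall u v, Cmod u <= d -> Cmod v <= d -> Cmod (u * v) <= d).
  { intros u v Hu Hv; rewrite Cmod_mult; replace d with (d * 1) by ring.
    apply Rmult_le_compat; try apply Cmod_ge_0; nra. }
  assert (H2 : Cmod (D * D + D * E + E * E) <= 3 * d).
  { pose proof (Cmod_triangle (D * D + D * E) (E * E)).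
    pose proof (Cmod_triangle (D * D) (D * E)).
    pose proof (Hprod D D HD HD); pose proof (Hprod D E HD HE);
    pose proof (Hprod E E HE HE); lra. }
  unfold W; eapply Rle_lt_trans; [apply Cmod_triangle|].
  rewrite !(Cmod_mult (RtoC _)), !Cmod_R; nra. }
destruct (Ceq_dec (D - E) 0) as [HDE|HDE].
- transitivity (E + (D - E))%C; [ring|rewrite HDE; ring].
- assert (H1 : W = 1).
  { transitivity (1 - (D - E) * (1 - W) / (D - E))%C; [field; easy|].
    rewrite H0; field; easy. }
  rewrite H1, Cmod_1 in HW; lra.
Qed.

Theorem theorem6p6 (a b : R) (ha : 0 < a) (hb : b <> 0)
    (hab : a ^ 2 + 3 * b <> 0) :
  locally (T := C_UniformSpace) (RtoC 0) (fun z : C =>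
    is_pseries (Dcoef a b) z
      ((phi a b (g a b z) * RtoC (sqrt (Rabs (a ^ 2 + 3 * b))) - RtoC a)
         / RtoC (3 * b))%C
    /\
    (z <> RtoC 0 ->
     is_pseries (Ccoef a b) z
       ((phi a b (g a b z) * RtoC (sqrt (Rabs (a ^ 2 + 3 * b))) - RtoC a)
          / (RtoC (3 * b) * z))%C)).
Proof.
destruct (closed_form_root a b ha hb hab) as (c & Hc & HE).
pose proof (Rabs_pos a) as Ha; pose proof (Rabs_pos b) as Hb.
set (d := / (1 + 2 * Rabs a + 3 * Rabs b)).
assert (Hd : 0 < d) by (apply Rinv_0_lt_compat; lra).
set (e := / (1 + 4 * Rabs a + 8 * Rabs b)).
assert (He : 0 < e) by (apply Rinv_0_lt_compat; lra).
(* [d] is a radius of uniqueness and [e] ensures convergence. With [d / 4] the bound [|l| <= 4]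
   gives [|z l| <= d]; with [d * c] the bound [|E| c <= |z|] gives [|E| <= d]. *)
set (rho := Rmin (Rmin (d / 4) (d * c)) e).
assert (Hrho : 0 < rho / 2).
{ apply Rdiv_lt_0_compat; [|lra]; repeat apply Rmin_glb_lt; try lra; nra. }
(* Balls in [C] are squares, so the radius is halved to control [Cmod z] by [|Re z| + |Im z|]. *)
exists (mkposreal _ Hrho); intros z [Hz1 Hz2].
change (Rabs (Re z - 0) < rho / 2) in Hz1; change (Rabs (Im z - 0) < rho / 2) in Hz2.
rewrite Rminus_0_r in Hz1, Hz2.
assert (Hz : Cmod z <= rho) by (pose proof (Cmod_le_Re_Im z); lra).
pose proof (Cmod_ge_0 z) as Hz0.
assert (Hzd : Cmod z <= d / 4)
  by (eapply Rle_trans; [exact Hz|eapply Rle_trans; [apply Rmin_l|apply Rmin_l]]).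
assert (Hzc : Cmod z <= d * c)
  by (eapply Rle_trans; [exact Hz|eapply Rle_trans; [apply Rmin_l|apply Rmin_r]]).
assert (Hze : Cmod z <= e) by (eapply Rle_trans; [exact Hz|apply Rmin_r]).
assert (He1 : e * (1 + 4 * Rabs a + 8 * Rabs b) = 1) by (unfold e; field; lra).
destruct (ex_pseries_Ccoef a b z) as (l & Hl & Hl4 & Hfun).
{ assert (Cmod z <= 1) by nra.
  assert (Cmod z ^ 2 <= Cmod z) by nra.
  nra. }
assert (Hlz : (z * l)%C = closed_form a b z).
{ destruct (HE z) as [Hroot Hq].
  set (E := closed_form a b z) in *; set (q := (1 - _ - _)%C) in Hroot, Hq.
  apply (small_root_unique a b d).
  - unfold d; apply Req_le; field; lra.
  - exact Hd.
  - rewrite Cmod_mult; pose proof (Cmod_ge_0 l); nra.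
  - apply Rmult_le_reg_r with c; [exact Hc|].
    apply Rle_trans with (Cmod z); [|exact Hzc].
    rewrite <- Hroot, Cmod_mult; apply Rmult_le_compat_l; [apply Cmod_ge_0|exact Hq].
  - fold q; rewrite Hroot.
    transitivity (z * (l - z * (RtoC a * (l * l) + RtoC b * z * (l * (l * l)))))%C;
      [ring|].
    rewrite Hfun at 1; ring. }
split.
- fold (closed_form a b z); rewrite <- Hlz; exact (is_pseries_incr_1 _ _ _ Hl).
- intros Hne; replace (_ / (RtoC (3 * b) * z))%C with l; [exact Hl|].
  transitivity (closed_form a b z / z)%C; [rewrite <- Hlz; field; easy|].
  unfold closed_form; field; split; [easy|].
  intros H; apply RtoC_inj in H; lra.
Qed.
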